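(* Let $(a_n)_{n\in\mathbb{N}}$ be a real valued sequence. Suppose that either $\sum_{n=1}^\infty|a_n|<1/16$, or $(a_n)_{n\in\mathbb{N}}$ decreases convexly to $0$ and satisfies $a_1\leq 1/8$. Then there exist a measure preserving system $(X,\mathcal{X},\mu,T)$ and a set $A\in\mathcal{X}$ such that $$\mu(A\cap T^{-n}A)-\mu(A)^2=a_n\quad\text{for every } n\in\mathbb{N}.$$
   Context: A measure preserving system is a quadruple $(X,\mathcal{X},\mu,T)$ where $(X,\mathcal{X},\mu)$ is a probability space and $T\colon X\to X$ is a measure preserving transformation (no ergodicity is assumed). $\mathbb{N}=\{1,2,\ldots\}$. A real sequence $(a_n)_{n\in\mathbb{N}}$ decreases convexly to $0$ if it converges to $0$ and satisfies $a_{n-1}+a_{n+1}-2a_n\geq 0$ for every $n\geq 2$. *)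

(* Defs.v *)
From HB Require Import structures.
From mathcomp Require Import all_boot all_order all_algebra.
From mathcomp Require Import all_classical all_reals all_analysis.

Set Implicit Arguments.
Unset Strict Implicit.
Unset Printing Implicit Defensive.

Import Order.TTheory GRing.Theory Num.Theory.
Import numFieldNormedType.Exports.

Local Open Scope classical_set_scope.
Local Open Scope ring_scope.

(** A sequence [(a_n)] indexed by [n >= 1] is a function [a : nat -> R] whose
    value at [0] is never constrained. *)

Definition decreases_convexly_to_0 (R : realType) (a : nat -> R) : Prop :=
  a n @[n --> \oo] --> (0 : R) /\
  forall n : nat, (2 <= n)%N -> 0 <= a n.-1 + a n.+1 - 2 * a n.

(** [T] need not be invertible, nor the system ergodic. *)
Definition measure_preserving (R : realType) (d : measure_display)
    (X : measurableType d) (mu : probability X R) (T : X -> X) : Prop :=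
  measurable_fun setT T /\
  forall B : set X, measurable B -> mu (T @^-1` B) = mu B.

(* Main.v *)
(** Fix independent fair coins, realised as the binary digits of a
    Lebesgue-random point of [0, 1[ under the doubling map.  Cut the time axis
    into blocks of length [L], with a uniformly random phase, and let the state
    at each time be read off, possibly flipped, from a coin attached to some
    position of the block.  This process has mean 1/2, its covariance is
    [s / 4] times the probability that the two times read the same coin
    ([s = 1] or [s = -1] according to the flips), and the covariances of a
    mixture of such processes over [L] are the averages of the covariances.

    If [a] is summable, use [L = 2 k] and let the positions [p] and [p + k]
    share a coin, flipped when [a k < 0]: this contributes to the lag [k] only,
    with correlation 1/2 in absolute value; the mass left over goes to
    [L = 1].  If [a] is convex, use one coin per
    block, which gives the covariance [max (0, 1 - n / L) / 4]; after setting
    [a 0 = 1 / 4] the sequence [a] is a mixture of these, with weights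
    proportional to [L] times its second differences. *)
From HB Require Import structures.
Require Import Defs.
From mathcomp Require Import all_boot all_order all_algebra.
From mathcomp Require Import all_classical all_reals all_analysis.
From mathcomp Require Import measurable_realfun.
From mathcomp Require Import zify ring lra.
Import Order.TTheory GRing.Theory Num.Theory.
Import numFieldNormedType.Exports.
Local Open Scope classical_set_scope.
Local Open Scope ring_scope.

Set Implicit Arguments.
Unset Strict Implicit.

(* [pushforward] carries its measure structure only under a measurability
   hypothesis; recording the latter as an argument makes it canonical. *)
Definition image_measure d d' (T1 : measurableType d) (T2 : measurableType d')
    (R : realFieldType) (m : {measure set T1 -> \bar R}) (f : T1 -> T2)
    of measurable_fun setT f := pushforward m f.

HB.instance Definition _ d d' (T1 : measurableType d) (T2 : measurableType d')
    (R : realFieldType) (m : {measure set T1 -> \bar R}) (f : T1 -> T2)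
    (mf : measurable_fun setT f) :=
  Measure.copy (image_measure m mf)
    (measure_function_pushforward__canonical__measure_function_Measure m mf).

(** * The doubling map *)

Section doubling_map.
Variable R : realType.
Local Notation Y := (measurableTypeR R).
Local Notation lambda := (@lebesgue_measure R).

Let affine (b : R) : Y -> Y := fun x => 2 * x - b.

Let measurable_affine b : measurable_fun setT (affine b).
Proof. by apply: measurable_funB => //; exact: measurable_funM. Qed.

(** Twice the image of Lebesgue measure under [2 * x - b] agrees with it on the intervals []x, y]],
    hence on all measurable sets. *)
Lemma lebesgue_measure_preimage_affine (b : R) (B : set Y) : measurable B ->
  lambda ((fun x : R => 2 * x - b) @^-1` B) = ((2^-1)%:E * lambda B)%E.
Proof.
move=> mB.
pose m := mscale (NngNum (ler0n R 2))
  (image_measure lambda (measurable_affine b)).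
have -> : lambda B = m B.
  apply: lebesgue_measure_unique => // _ [[x y] _ <-] /=.
  rewrite /m/= /mscale/= /image_measure /pushforward/=.
  have -> : affine b @^-1` `]x, y] = `](x + b) / 2, (y + b) / 2]%classic.
    by apply/seteqP; split=> z /=; rewrite !in_itv/= /affine; lra.
  rewrite !lebesgue_measure_itv/= !lte_fin.
  have -> : ((x + b) / 2 < (y + b) / 2) = (x < y) by apply/idP/idP; lra.
  case: ifP => _; last by rewrite mule0.
  by rewrite -!EFinD -EFinM; congr EFin; lra.
by rewrite /m /mscale/= muleA -EFinM mulVf// mul1e.
Qed.

Definition doubling (u : Y) : Y := if u < 2^-1 then 2 * u else 2 * u - 1.

Definition lower_half : set Y := [set u : R | u < 2^-1].

Definition unit_lebesgue : {measure set Y -> \bar R} :=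
  mrestr lambda (measurable_itv `[0 : R, 1[).

Lemma unit_lebesgueT : unit_lebesgue setT = 1%E.
Proof.
rewrite /unit_lebesgue/= /mrestr setTI lebesgue_measure_itv/= lte_fin ltr01.
by rewrite oppr0 adde0.
Qed.

Lemma measurable_lower_half : measurable lower_half.
Proof.
have -> : lower_half = `]-oo, 2^-1[%classic.
  by apply/seteqP; split=> z; rewrite /= in_itv.
exact: measurable_itv.
Qed.

Lemma measurable_doubling : measurable_fun setT doubling.
Proof.
have mlt : measurable_fun setT (fun u : Y => (u : R) < 2^-1).
  exact: measurable_fun_ltr.
apply: measurable_fun_ifT => //.
exact: measurable_affine.
Qed.

(** Each half of [[0, 1[] is mapped affinely onto [[0, 1[], so the first binary digit is a fair coin
    independent of the image point. *)
Lemma doubling_lower (B : set Y) : measurable B ->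
  unit_lebesgue (lower_half `&` doubling @^-1` B) =
  ((2^-1)%:E * unit_lebesgue B)%E.
Proof.
move=> mB; rewrite /unit_lebesgue/= /mrestr.
rewrite -(lebesgue_measure_preimage_affine 0).
  congr (lambda _); apply/seteqP; split=> u/=; rewrite /lower_half /doubling/=.
    by rewrite !in_itv/= subr0 => -[[h]]; rewrite h => ? ?; split=> //; lra.
  rewrite !in_itv/= subr0 => -[? ?].
  have -> : u < 2^-1 by lra.
  by split=> //; lra.
by apply: measurableI => //; exact: measurable_itv.
Qed.

Lemma doubling_upper (B : set Y) : measurable B ->
  unit_lebesgue (~` lower_half `&` doubling @^-1` B) =
  ((2^-1)%:E * unit_lebesgue B)%E.
Proof.
move=> mB; rewrite /unit_lebesgue/= /mrestr.
rewrite -(lebesgue_measure_preimage_affine 1).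
  congr (lambda _); apply/seteqP; split=> u/=; rewrite /lower_half /doubling/=.
    rewrite !in_itv/= => -[[/negP/negbTE h]]; rewrite h => ? ?.
    by split=> //; lra.
  rewrite !in_itv/= => -[? ?].
  have -> : (u < 2^-1) = false by lra.
  by split=> //; lra.
by apply: measurableI => //; exact: measurable_itv.
Qed.

End doubling_map.

(** The common conclusion of the summable and the convex case. *)
Definition indicator_autocovariance (R : realType) (a : nat -> R) : Prop :=
  exists (d : measure_display) (X : measurableType d) (mu : probability X R)
    (T : X -> X) (A : set X),
    [/\ measure_preserving mu T,
        measurable A &
        forall n : nat, (1 <= n)%N ->
          (mu (A `&` iter n T @^-1` A) - mu A ^+ 2 = (a n)%:E)%E].

(** * Mixtures of block processes *)

Section skew_product.
Context d (Y : measurableType d) (R : realType).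
Variables (nu : {measure set Y -> \bar R}) (g : Y -> Y) (D : set Y).
Hypotheses (nuT : nu setT = 1%E) (mg : measurable_fun setT g)
  (mD : measurable D).
(** [D] is a fair coin independent of all that is seen after one step of [g]; adding this identity
    and the next shows that [g] preserves [nu]. *)
Hypothesis nu_D : forall B, measurable B ->
  nu (D `&` g @^-1` B) = ((2^-1)%:E * nu B)%E.
Hypothesis nu_DC : forall B, measurable B ->
  nu (~` D `&` g @^-1` B) = ((2^-1)%:E * nu B)%E.

Definition digit (b : bool) (n : nat) : set Y :=
  iter n g @^-1` (if b then D else ~` D).

Let measurable_preimage B : measurable B -> measurable (g @^-1` B).
Proof. by move=> mB; rewrite -[X in measurable X]setTI; exact: mg. Qed.

Let digitS b n : digit b n.+1 = g @^-1` digit b n.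
Proof. by apply/seteqP; split=> u; rewrite /digit /preimage /mkset iterSr. Qed.

Lemma measurable_digit b n : measurable (digit b n).
Proof.
elim: n => [|n IHn]; last by rewrite digitS; exact: measurable_preimage.
by rewrite /digit/=; case: b => //; exact: measurableC.
Qed.
#[local] Hint Resolve measurable_digit : core.

Let nu_digit0I b B : measurable B ->
  nu (digit b 0 `&` g @^-1` B) = ((2^-1)%:E * nu B)%E.
Proof. by move=> mB; case: b; [exact: nu_D|exact: nu_DC]. Qed.

Lemma measure_preimage_shift B : measurable B -> nu (g @^-1` B) = nu B.
Proof.
move=> mB; have mgB := measurable_preimage mB.
have -> : nu (g @^-1` B) = (nu (~` D `&` g @^-1` B) + nu (D `&` g @^-1` B))%E.
  by rewrite (measureDI _ mgB mD) setDE (setIC _ D) (setIC _ (~` D)).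
rewrite nu_D// nu_DC//.
by rewrite -ge0_muleDl// -EFinD (_ : _ + _ = 1) ?mul1e//; lra.
Qed.

Lemma measure_digit b n : nu (digit b n) = (2^-1)%:E.
Proof.
elim: n => [|n IHn]; last by rewrite digitS measure_preimage_shift.
by rewrite -[digit b 0]setIT -[setT](preimage_setT g) nu_digit0I// nuT mule1.
Qed.

(** Invariance lowers both indices until the earlier one is 0, where independence applies. *)
Let measure_digitI_lt b b' i j : (i < j)%N ->
  nu (digit b i `&` digit b' j) = (4^-1)%:E.
Proof.
elim: i j => [|i IHi] [|j]// ij.
  by rewrite digitS nu_digit0I// measure_digit -EFinM; congr EFin; lra.
rewrite !digitS -preimage_setI measure_preimage_shift; first exact: IHi.
exact: measurableI.
Qed.

(** The correlation of two coin events, that is, 4 times their covariance. *)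
Definition agreement (b b' : bool) (i j : nat) : R :=
  if i == j then (-1) ^+ (b (+) b') else 0.

Lemma measure_digitI b b' i j :
  nu (digit b i `&` digit b' j) = ((1 + agreement b b' i j) / 4)%:E.
Proof.
rewrite /agreement; case: ltngtP => [ij|ij|<-].
- by rewrite measure_digitI_lt//; congr EFin; lra.
- by rewrite setIC measure_digitI_lt//; congr EFin; lra.
have [<-|bb'] := eqVneq b b'.
  by rewrite setIid measure_digit addbb expr0; congr EFin; lra.
have -> : digit b i `&` digit b' i = set0.
  case: b b' bb' => -[]// _; rewrite -preimage_setI ?setICr ?setICl;
    by rewrite preimage_set0.
rewrite measure0; case: b b' bb' => -[]// _; rewrite /= expr1; congr EFin; lra.
Qed.

(* The [k]-th component of the mixture has blocks of length [(ell k).+1] and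
   weight [v k] for each phase.  At position [p] of a block the process reads,
   with orientation [b k p], the coin [c k p] steps ahead of the current
   time. *)
Variables (ell : nat -> nat) (v : nat -> R) (b : nat -> nat -> bool)
  (c : nat -> nat -> nat).
Hypothesis v_ge0 : forall k, 0 <= v k.

Definition rotate (k p : nat) : nat := if (p < ell k)%N then p.+1 else 0%N.

Lemma iter_rotate k p n : (p <= ell k)%N ->
  iter n (rotate k) p = ((p + n) %% (ell k).+1)%N.
Proof.
move=> pk; elim: n => [|n IHn] /=; first by rewrite addn0 modn_small.
rewrite IHn addnS -[in RHS](addn1 (p + n)) -[in RHS]modnDml addn1 /rotate.
have := ltn_pmod (p + n) (ltn0Sn (ell k)); rewrite ltnS leq_eqVlt.
case/orP => [/eqP ->|lt]; first by rewrite ltnn modnn.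
by rewrite lt [RHS]modn_small.
Qed.

Definition skew (x : (nat * nat) * Y) : (nat * nat) * Y :=
  ((x.1.1, rotate x.1.1 x.1.2), g x.2).

Lemma iter_skew n k p u :
  iter n skew ((k, p), u) = ((k, iter n (rotate k) p), iter n g u).
Proof. by elim: n => //= n ->. Qed.

(** The index set is countable, so [B] is a countable union of rectangles. *)
Lemma measurable_section (B : set ((nat * nat) * Y)) :
  (forall i, measurable (pair i @^-1` B)) -> measurable B.
Proof.
move=> mB.
have -> : B = \bigcup_k \bigcup_p ([set (k, p)] `*` (pair (k, p) @^-1` B)).
  apply/seteqP; split=> [[[k p] u] Bx|[i u] [k _ [p _ [/= -> //]]]].
  by exists k => //; exists p.
apply: bigcupT_measurable => k; apply: bigcupT_measurable => p.
apply: measurableX => //.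
have -> : [set (k, p)] = [set k] `*` [set p].
  by apply/seteqP; split=> [_ ->|[_ _] [/= -> ->]].
exact: measurableX.
Qed.

Let measurable_fiber i (B : set ((nat * nat) * Y)) :
  measurable B -> measurable (pair i @^-1` B).
Proof. by move=> mB; rewrite -[_ @^-1` _]setTI; exact: pair1_measurable. Qed.

Let fiber (i : nat * nat) : {measure set ((nat * nat) * Y) -> \bar R} :=
  image_measure nu (pair1_measurable i).

(** Phases above [ell k] get no mass: component [k] lives on the cycle permuted by [rotate k]. *)
Definition mixture : {measure set ((nat * nat) * Y) -> \bar R} :=
  mseries (fun k => msum (fun p => mscale (NngNum (v_ge0 k)) (fiber (k, p)))
    (ell k).+1) 0.

Lemma mixtureE B : mixture B =
  (\sum_(0 <= k <oo) \sum_(p < (ell k).+1)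
    (v k)%:E * nu (pair (k, p : nat) @^-1` B))%E.
Proof. by []. Qed.

Lemma mixture_lim B (x : nat -> nat -> R) (l : R) :
  (forall k p, (p <= ell k)%N -> nu (pair (k, p) @^-1` B) = (x k p)%:E) ->
  series (fun k => v k * \sum_(p < (ell k).+1) x k p) @ \oo --> l ->
  mixture B = l%:E.
Proof.
move=> xE xl; rewrite mixtureE; apply: cvg_lim => //.
have -> : (fun n => \sum_(0 <= k < n) \sum_(p < (ell k).+1)
      (v k)%:E * nu (pair (k, p : nat) @^-1` B))%E =
    EFin \o series (fun k => v k * \sum_(p < (ell k).+1) x k p).
  apply/funext => n; rewrite /= /series/= -sumEFin; apply: eq_bigr => k _.
  rewrite mulr_sumr -sumEFin; apply: eq_bigr => p _.
  by rewrite xE ?EFinM// -ltnS.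
by apply: (cvg_comp _ _ xl).
Qed.

Lemma measure_preserving_skew (mu : probability ((nat * nat) * Y)%type R) :
  (forall B, mu B = mixture B) -> measure_preserving mu skew.
Proof.
move=> muE; split=> [_ B mB|B mB].
  rewrite setTI; apply: measurable_section => -[k p].
  have -> : pair (k, p) @^-1` (skew @^-1` B) =
    g @^-1` (pair (k, rotate k p) @^-1` B) by [].
  exact/measurable_preimage/measurable_fiber.
rewrite !muE !mixtureE; apply: eq_eseriesr => k _.
pose F p := ((v k)%:E * nu (pair (k, p) @^-1` B))%E.
transitivity (\sum_(p < (ell k).+1) F (rotate k p))%E.
  apply: eq_bigr => p _; rewrite /F; congr (_ * _)%E.
  exact: (measure_preimage_shift (measurable_fiber (k, rotate k p) mB)).
(* The last phase returns to 0 and every other one moves up by one. *)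
rewrite big_ord_recr big_ord_recl /= addeC; congr (_ + _)%E.
  by rewrite /rotate ltnn.
by apply: eq_bigr => p _; rewrite /rotate ltn_ord.
Qed.

(** The first series is the total mass. As [A] has measure 1/2, its covariance is a quarter of the
    mean agreement, whence [4 * a n]. *)
Lemma exists_process_covariance (a : nat -> R) :
  series (fun k => v k * (ell k).+1%:R) @ \oo --> (1 : R) ->
  (forall n, (1 <= n)%N ->
    series (fun k => v k * \sum_(p < (ell k).+1)
      agreement (b k p) (b k ((p + n) %% (ell k).+1))
        (c k p) (c k ((p + n) %% (ell k).+1) + n)) @ \oo --> 4 * a n) ->
  indicator_autocovariance a.
Proof.
move=> mass cov.
have mixture_cst B (x : R) :
    (forall k p, (p <= ell k)%N -> nu (pair (k, p) @^-1` B) = x%:E) ->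
    mixture B = x%:E.
  move=> BE; apply: (mixture_lim (x := fun _ _ => x)) => //.
  have -> : series (fun k => v k * \sum_(p < (ell k).+1) x) =
      (fun n => x * series (fun k => v k * (ell k).+1%:R) n).
    apply/funext => n; rewrite /series/= mulr_sumr; apply: eq_bigr => k _.
    by rewrite sumr_const card_ord -[x *+ _]mulr_natr; ring.
  by rewrite -[X in _ --> X]mulr1; exact: cvgMl_tmp.
have mixtureT : mixture setT = 1%E by exact: mixture_cst.
pose mixP := Measure_isProbability.Build _ _ _ mixture mixtureT.
pose mu : probability ((nat * nat) * Y)%type R :=
  HB.pack (Measure.sort mixture) mixP.
pose A : set ((nat * nat) * Y) :=
  [set x | digit (b x.1.1 x.1.2) (c x.1.1 x.1.2) x.2].
have AE k p : pair (k, p) @^-1` A = digit (b k p) (c k p) by [].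
have mA : measurable A by apply: measurable_section => -[k p]; rewrite AE.
have muA : mixture A = (2^-1)%:E.
  by apply: mixture_cst => k p _; rewrite AE measure_digit.
exists _, _, mu, skew, A; split=> // [|n n1].
  exact: measure_preserving_skew.
rewrite [mu A]muA.
have -> : mu (A `&` iter n skew @^-1` A) = (4^-1 + a n)%:E; last first.
  by rewrite -EFin_expe -EFinB; congr EFin; lra.
apply: (mixture_lim (x := fun k p =>
    (1 + agreement (b k p) (b k ((p + n) %% (ell k).+1))
        (c k p) (c k ((p + n) %% (ell k).+1) + n)) / 4)) => [k p pk|].
  (* A coin lying [c] steps ahead after [n] iterations lies [c + n] steps ahead now. *)
  rewrite -measure_digitI; congr (nu _).
  apply/seteqP; split=> u; rewrite /A/= iter_skew/= iter_rotate//.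
    by rewrite /digit/= iterD.
  by rewrite /digit/= iterD.
have -> : series (fun k => v k * \sum_(p < (ell k).+1)
    (1 + agreement (b k p) (b k ((p + n) %% (ell k).+1))
        (c k p) (c k ((p + n) %% (ell k).+1) + n)) / 4) =
    (fun m => 4^-1 * (series (fun k => v k * (ell k).+1%:R) m +
    series (fun k => v k * \sum_(p < (ell k).+1)
      agreement (b k p) (b k ((p + n) %% (ell k).+1))
        (c k p) (c k ((p + n) %% (ell k).+1) + n)) m)).
  apply/funext => m; rewrite /series/= -big_split/= mulr_sumr.
  apply: eq_bigr => k _; rewrite -mulr_suml big_split/= sumr_const card_ord.
  ring.
have -> : 4^-1 + a n = 4^-1 * (1 + 4 * a n) by lra.
by apply: cvgMl_tmp; apply: cvgD => //; exact: cov.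
Qed.
End skew_product.

Lemma covariance_of_series (R : realType) (a : nat -> R) (ell : nat -> nat)
    (v : nat -> R) (b : nat -> nat -> bool) (c : nat -> nat -> nat) :
  (forall k, 0 <= v k) ->
  series (fun k => v k * (ell k).+1%:R) @ \oo --> (1 : R) ->
  (forall n, (1 <= n)%N ->
    series (fun k => v k * \sum_(p < (ell k).+1)
      agreement R (b k p) (b k ((p + n) %% (ell k).+1)%N)
        (c k p) (c k ((p + n) %% (ell k).+1) + n)%N) @ \oo --> 4 * a n) ->
  indicator_autocovariance a.
Proof.
move=> v_ge0; exact: (exists_process_covariance (@unit_lebesgueT R)
  (@measurable_doubling R) (@measurable_lower_half R) (@doubling_lower R)
  (@doubling_upper R)).
Qed.

Lemma sum_ltn_ord N M : (\sum_(p < N) (p < M))%N = minn N M.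
Proof.
elim: N => [|N IHN]; first by rewrite big_ord0 min0n.
by rewrite big_ord_recr/= IHN; lia.
Qed.

(** * Summable sequences *)

Section summable.
Variables (R : realType) (a : nat -> R).
Hypothesis ha : (\sum_(1 <= n <oo) (`|a n|)%:E < (1 / 16)%:E)%E.

Lemma cvg_sum_abs : exists2 S : R, S < 1 / 16 &
  (fun n => \sum_(1 <= k < n) `|a k|) @ \oo --> S.
Proof.
set e := (fun n => \sum_(1 <= k < n) (`|a k|)%:E)%E.
have ce : e n @[n --> \oo] --> (\sum_(1 <= n <oo) (`|a n|)%:E)%E.
  by apply: is_cvg_nneseries => n _ _; rewrite lee_fin.
have s_ge0 : (0 <= \sum_(1 <= n <oo) (`|a n|)%:E)%E.
  by apply: nneseries_ge0 => n _ _; rewrite lee_fin.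
have sfin : (\sum_(1 <= n <oo) (`|a n|)%:E)%E \is a fin_num.
  by rewrite ge0_fin_numE// (lt_trans ha)// ltry.
exists (fine (\sum_(1 <= n <oo) (`|a n|)%:E)%E).
  by rewrite -lte_fin fineK.
have -> : (fun n => \sum_(1 <= k < n) `|a k|) = fine \o e.
  by apply/funext => n; rewrite /e/= sumEFin.
by apply: fine_cvg; rewrite fineK.
Qed.

(** Block length [2 k], except that [k = 0] gives length 1 since [0.-1 = 0]: that component is the
    plain coin sequence. *)
Let ell (k : nat) : nat := k.*2.-1.
Let c (k p : nat) : nat := if (p < k)%N then k else 0%N.
Let b (k p : nat) : bool := (p < k)%N && (a k < 0).

(** As [c k] takes only the values 0 and [k], a common coin at lag [n >= 1] forces the values [k],
    then 0, and [n = k]; it then occurs exactly at the [k] positions of the first half. *)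
Let sum_agreement k n : (1 <= n)%N -> (0 < k)%N ->
  \sum_(p < (ell k).+1)
    agreement R (b k p) (b k ((p + n) %% (ell k).+1)%N)
        (c k p) (c k ((p + n) %% (ell k).+1) + n)%N =
  if k == n then k%:R * (-1) ^+ (a k < 0)%R else 0.
Proof.
move=> n1 k0; have -> : (ell k).+1 = k.*2 by rewrite /ell; lia.
have [<-|kn] := eqVneq k n.
  have E (p : 'I_k.*2) : agreement R (b k p) (b k ((p + k) %% k.*2)%N)
     (c k p) (c k ((p + k) %% k.*2) + k)%N = (p < k)%N%:R * (-1) ^+ (a k < 0)%R.
    rewrite /agreement /c /b; case: ltnP => pk.
      rewrite modn_small; last lia.
      have -> : (p + k < k)%N = false by lia.
      by rewrite eqxx addbF mul1r.
    by rewrite mul0r ifF//; case: ifP; lia.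
  rewrite (eq_bigr _ (fun p _ => E p)) -mulr_suml -natr_sum sum_ltn_ord.
  by congr (_%:R * _); lia.
apply: big1 => p _; rewrite /agreement /c; case: ifP => // /eqP.
by case: ifP; case: ifP; lia.
Qed.

Lemma summable_covariance :
  indicator_autocovariance a.
Proof.
have [S S16 cS] := cvg_sum_abs.
(* The [k] agreeing positions turn this weight into [4 * |a k|]; the [2 k] phases give mass
   [8 * |a k|], and [S < 1 / 16] makes the remainder nonnegative. *)
pose v k := if k == 0%N then 1 - 8 * S else 4 * `|a k| / k%:R.
apply: (covariance_of_series (ell := ell) (v := v) (b := b) (c := c)).
- move=> [|k]; rewrite /v/=; first by lra.
  by rewrite divr_ge0// mulr_ge0.
- rewrite -[X in _ --> X](subrK (8 * S)) -cvg_shiftS.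
  have -> : (fun n => series (fun k => v k * (ell k).+1%:R) n.+1) =
      (fun n => 1 - 8 * S + 8 * \sum_(1 <= k < n.+1) `|a k|).
    apply/funext => n; rewrite /series/= big_nat_recl// big_add1/=.
    rewrite mulr1 mulr_sumr; congr (_ + _); apply: eq_bigr => k _.
    rewrite /v/= (_ : (ell k.+1).+1 = 2 * k.+1)%N; last by rewrite /ell; lia.
    by rewrite natrM; field.
  apply: cvgD; [exact: cvg_cst|apply: cvgMl_tmp].
  by rewrite (cvg_shiftS (fun n => \sum_(1 <= k < n) `|a k|)).
- move=> n n1.
  have E k : v k * (\sum_(p < (ell k).+1)
      agreement R (b k p) (b k ((p + n) %% (ell k).+1)%N)
        (c k p) (c k ((p + n) %% (ell k).+1) + n)%N) =
      if k == n then 4 * a n else 0.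
    case: k => [|k].
      rewrite ifF; last lia.
      rewrite big1 ?mulr0// => p _; rewrite /agreement /c ifF//=; lia.
    rewrite sum_agreement//; case: eqP => [<-|_]; last by rewrite mulr0.
    have -> : v k.+1 = 4 * `|a k.+1| / k.+1%:R by [].
    rewrite mulrA divfK ?pnatr_eq0//.
    case: ltP => h /=; first by rewrite expr1 ltr0_norm//; ring.
    by rewrite expr0 ger0_norm// mulr1.
  apply: cvg_near_cst; near=> N; rewrite /series/=.
  rewrite (eq_bigr _ (fun k _ => E k)) -big_mkcond/=.
  rewrite big_nat1_eq ifT//.
  near: N; exact: nbhs_infty_gt.
Unshelve. all: by end_near. Qed.
End summable.

(** * Convex sequences *)

Section convex.
Variables (R : realType) (u : nat -> R).
Hypotheses (u_convex : forall k, 0 <= u k + u k.+2 - 2 * u k.+1)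
  (u_cvg0 : u @ \oo --> (0 : R)).

Let diff k := u k - u k.+1.

Let diff_nonincreasing : nonincreasing_seq diff.
Proof.
by apply/nonincreasing_seqP => k; have := u_convex k; rewrite /diff; lra.
Qed.

(** The differences decrease to their limit 0. *)
Let diff_ge0 k : 0 <= diff k.
Proof.
have cdiff : diff @ \oo --> (0 : R).
  rewrite -[X in _ --> X](subr0 0); apply: cvgB => //.
  by rewrite (cvg_shiftS u).
rewrite -(cvg_lim _ cdiff)//; apply: nonincreasing_cvgn_ge => //.
by apply/cvg_ex; exists 0.
Qed.

Let u_nonincreasing : nonincreasing_seq u.
Proof.
by apply/nonincreasing_seqP => k; have := diff_ge0 k; rewrite /diff; lra.
Qed.

Lemma convex_cvg0_ge0 k : 0 <= u k.
Proof.
rewrite -(cvg_lim _ u_cvg0)//; apply: nonincreasing_cvgn_ge => //.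
by apply/cvg_ex; exists 0.
Qed.

Let cvg_half : (fun m => u m./2) @ \oo --> (0 : R).
Proof.
apply: (cvg_comp _ _ _ u_cvg0).
apply/cvgnyPge => A; near=> n.
by rewrite -(half_double A) half_leq//; near: n; exact: nbhs_infty_ge.
Unshelve. all: by end_near. Qed.

(* Summing the nonincreasing differences over [m/2, m) gives
   m/2 * diff m <= u (m/2). *)
Let muln_diff_le n m : m%:R * diff (m + n)%N <= 2 * u m./2.
Proof.
have sum_le h j : j%:R * diff (h + j)%N <= u h - u (h + j)%N.
  elim: j => [|j IHj]; first by rewrite mul0r addn0 subrr.
  have le : diff (h + j.+1)%N <= diff (h + j)%N.
    by apply: diff_nonincreasing; lia.
  have : j.+1%:R * diff (h + j.+1)%N <= j.+1%:R * diff (h + j)%N.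
    by rewrite ler_wpM2l.
  move: IHj; rewrite -natr1 addnS /diff; lra.
have le1 : diff (m + n)%N <= diff m.
  by apply: diff_nonincreasing; exact: leq_addr.
have le2 : m%:R * diff (m + n)%N <= m%:R * diff m by rewrite ler_wpM2l.
have := sum_le m./2 (m - m./2)%N; rewrite subnKC; last lia.
have := convex_cvg0_ge0 m.
have : m%:R * diff m <= 2 * ((m - m./2)%:R * diff m).
  by rewrite mulrA ler_wpM2r// -natrM ler_nat; lia.
lra.
Qed.

(** Summation by parts: truncated subtraction kills the terms [k < n], and the boundary term
    [m * diff (m + n)] tends to 0. The case [n = 0] will give the total mass, [n >= 1] the
    covariances. *)
Lemma series_second_difference n :
  series (fun k => (u k + u k.+2 - 2 * u k.+1) * (k.+1 - n)%:R) @ \oo --> u n.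
Proof.
rewrite -[X in _ --> X]subr0 -[X in u n - X]addr0 -(cvg_shiftn n).
have -> : (fun m => series (fun k => (u k + u k.+2 - 2 * u k.+1) *
      (k.+1 - n)%:R) (m + n)%N) =
    (fun m => u n - (u (m + n)%N + m%:R * diff (m + n)%N)).
  apply/funext; elim=> [|m IHm].
    rewrite add0n mul0r addr0 subrr /series/=.
    rewrite big_nat_cond big1// => k /andP[/andP[_ kn] _].
    by rewrite (_ : _ - _ = 0)%N ?mulr0//; lia.
  rewrite addSn; have := IHm; rewrite /series/= big_nat_recr//= => ->.
  by rewrite /diff (_ : (m + n).+1 - n = m.+1)%N ?addSn -?natr1; [ring|lia].
apply: cvgB; first exact: cvg_cst.
apply: cvgD; first by rewrite (cvg_shiftn n u).
apply: (@squeeze_cvgr _ _ _ _ (fun=> 0) (fun m => 2 * u m./2)).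
- near=> m; rewrite muln_diff_le andbT mulr_ge0//; exact: diff_ge0.
- exact: cvg_cst.
- by rewrite -[X in _ --> X](mulr0 2); exact: cvgMl_tmp.
Unshelve. all: by end_near. Qed.

End convex.

Lemma convex_covariance (R : realType) (a : nat -> R) :
  decreases_convexly_to_0 a -> a 1%N <= 1 / 8 ->
  indicator_autocovariance a.
Proof.
move=> [a_cvg0 a_convex] a1.
(* 1/4 is the variance of an event of measure 1/2. Convexity at the new first point reads
   [1 / 4 + a 2 >= 2 * a 1], which follows from [a 1 <= 1 / 8] and [a 2 >= 0]. *)
pose u k := if k is 0%N then 1 / 4 else a k.
have aS_cvg0 : (fun k => a k.+1) @ \oo --> (0 : R) by rewrite (cvg_shiftS a).
have u_cvg0 : u @ \oo --> (0 : R) by rewrite -cvg_shiftS.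
have aS_ge0 k : 0 <= a k.+1.
  apply: (@convex_cvg0_ge0 _ (fun k => a k.+1)) => // j.
  by have := a_convex j.+2 isT; rewrite /=; lra.
have u_convex k : 0 <= u k + u k.+2 - 2 * u k.+1.
  case: k => [|k]; rewrite /u; first by have := aS_ge0 1%N; lra.
  by have := a_convex k.+2 isT.
have cvg4 (f : nat -> nat -> R) n : (forall k, f n k = (k.+1 - n)%:R) ->
    series (fun k => 4 * (u k + u k.+2 - 2 * u k.+1) * f n k) @ \oo --> 4 * u n.
  move=> fE.
  have -> : series (fun k => 4 * (u k + u k.+2 - 2 * u k.+1) * f n k) =
      (fun m => 4 *
        series (fun k => (u k + u k.+2 - 2 * u k.+1) * (k.+1 - n)%:R) m).
    apply/funext => m; rewrite /series/= mulr_sumr.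
    by apply: eq_bigr => k _; rewrite fE mulrA.
  by apply: cvgMl_tmp; exact: series_second_difference.
(* Position [p] of a block of length [k.+1] looks [k - p] steps ahead, so the whole block reads the
   coin of its last position. *)
apply: (@covariance_of_series R a id
  (fun k => 4 * (u k + u k.+2 - 2 * u k.+1))
  (fun _ _ => true) (fun k p => k - p)%N).
- by move=> k; rewrite mulr_ge0.
- rewrite [X in _ --> X](_ : _ = 4 * u 0%N); last by rewrite /u; lra.
  by apply: (cvg4 (fun _ k => k.+1%:R) 0%N) => k; rewrite subn0.
- case=> // n _.
  apply: (cvg4 (fun n k => \sum_(p < k.+1)
    agreement R true true (k - p) (k - (p + n) %% k.+1 + n)) n.+1) => k.
  have E (p : 'I_k.+1) :
      agreement R true true (k - p) (k - (p + n.+1) %% k.+1 + n.+1) =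
      (p < k.+1 - n.+1)%N%:R.
    rewrite /agreement expr0.
    (* Within the block the coin is the same; past its end, the coin read lies at least
       [n.+1 > k - p] steps ahead. *)
    case: (ltnP (p + n.+1) k.+1) => pk.
      rewrite modn_small// ifT; last lia.
      by rewrite (_ : (_ < _)%N = true)//; lia.
    rewrite ifF; last lia.
    by rewrite (_ : (_ < _)%N = false)//; lia.
  rewrite (eq_bigr _ (fun p _ => E p)) -natr_sum sum_ltn_ord.
  by congr (_%:R); lia.
Qed.

Unset Implicit Arguments.

Theorem theorem2p4 (R : realType) (a : nat -> R)
    (ha : (\sum_(1 <= n <oo) (`|a n|)%:E < (1 / 16)%:E)%E \/
          (decreases_convexly_to_0 a /\ a 1%N <= 1 / 8)) :
  exists (d : measure_display) (X : measurableType d) (mu : probability X R)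
    (T : X -> X) (A : set X),
    [/\ measure_preserving mu T,
        measurable A &
        forall n : nat, (1 <= n)%N ->
          (mu (A `&` iter n T @^-1` A) - mu A ^+ 2 = (a n)%:E)%E].
Proof.
case: ha => [|[a_convex a1]]; first exact: summable_covariance.
exact: convex_covariance.
Qed.
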